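(* For integers $n, k \ge 0$ let $I(n,k)$ be the number of independent sets of size $k$ in the $132$-core $D_n$, and let $F(x,y) = \sum_{n,k \ge 0} I(n,k) x^n y^k$. Then $F$ satisfies \[ F = 1 + xF + \frac{xyF^2}{1 - y(F-1)}, \] and for all $n \ge 1$ and $k \ge 0$, \[ I(n,k) = \frac{1}{n}\sum_{j=0}^{n-1} \binom{n}{k-j}\binom{n}{j+1}\binom{n-1+j}{n-1}. \]
   Context: For an integer $n \ge 0$, the $132$-core of size $n$ is the simple undirected graph $D_n$ with vertex set $\{(i,j) : 1 \le i \le j \le n\}$, in which $(i,j)$ and $(k,\ell)$ are adjacent if and only if either $i < k \le j < \ell$, or $k < i \le \ell < j$. ($D_0$ is the empty graph with no vertices.) An independent set is a set of pairwise non-adjacent vertices; the empty set is the unique independent set of size $0$. Binomial coefficients $\binom{m}{r}$ with $r<0$ or $r>m\ge 0$ are $0$. *)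

(* Defs.v *)
From HB Require Import structures.
From mathcomp Require Import all_boot all_order all_algebra.
From mathcomp Require Import boolp.

Set Implicit Arguments.
Unset Strict Implicit.
Unset Printing Implicit Defensive.

Import GRing.Theory.
Local Open Scope ring_scope.

(* Formal power series: [fcoef f n] is the coefficient of degree n. Bivariate
   series are obtained by iterating: R[[x,y]] is fps (fps R), the outer variable
   being x and the inner one y. *)
Record fps (R : Type) := Fps { fcoef : nat -> R }.

Lemma fpsP (R : Type) (f g : fps R) :
  (forall n, fcoef f n = fcoef g n) -> f = g.
Proof. by case: f g => [f] [g] /= fg; congr Fps; apply: funext. Qed.

(* Leibniz equality is only classically decidable here, and there is no
   canonical choice operator, hence the generic (axiomatic) instances. *)
HB.instance Definition _ (R : Type) := gen_eqMixin (fps R).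
HB.instance Definition _ (R : Type) := gen_choiceMixin (fps R).

Section Zmodule.
Variable R : zmodType.
Implicit Types f g h : fps R.

Definition fps_zero : fps R := Fps (fun _ => 0).
Definition fps_opp f : fps R := Fps (fun n => - fcoef f n).
Definition fps_add f g : fps R := Fps (fun n => fcoef f n + fcoef g n).

Lemma fps_addA : associative fps_add.
Proof. by move=> f g h; apply: fpsP => n /=; rewrite addrA. Qed.
Lemma fps_addC : commutative fps_add.
Proof. by move=> f g; apply: fpsP => n /=; rewrite addrC. Qed.
Lemma fps_add0 : left_id fps_zero fps_add.
Proof. by move=> f; apply: fpsP => n /=; rewrite add0r. Qed.
Lemma fps_addN : left_inverse fps_zero fps_opp fps_add.
Proof. by move=> f; apply: fpsP => n /=; rewrite addNr. Qed.

HB.instance Definition _ :=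
  GRing.isZmodule.Build (fps R) fps_addA fps_addC fps_add0 fps_addN.

End Zmodule.

Section Ring.
Variable R : comNzRingType.
Implicit Types f g h : fps R.

Definition fpsC (c : R) : fps R := Fps (fun n => if n == 0%N then c else 0).
Definition fpsX : fps R := Fps (fun n => (n == 1%N)%:R).
Definition fps_mul f g : fps R :=
  Fps (fun n => \sum_(i < n.+1) fcoef f i * fcoef g (n - i)%N).

Definition fps_trunc n f : {poly R} := \poly_(i < n.+1) fcoef f i.

Lemma coef_fps_trunc n f i :
  (i <= n)%N -> (fps_trunc n f)`_i = fcoef f i.
Proof. by move=> le_in; rewrite coef_poly ltnS le_in. Qed.

Lemma fcoef_mul n f g i : (i <= n)%N ->
  fcoef (fps_mul f g) i = (fps_trunc n f * fps_trunc n g)`_i.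
Proof.
move=> le_in; rewrite coefM /=; apply: eq_bigr => j _.
rewrite !coef_fps_trunc ?(leq_trans (leq_subr _ _)) //.
by apply: leq_trans le_in; rewrite -ltnS.
Qed.

Lemma fps_mulA : associative fps_mul.
Proof.
move=> f g h; apply: fpsP => n; rewrite !(@fcoef_mul n) //.
have trM (u v w : {poly R}) : (forall i, (i <= n)%N -> u`_i = v`_i) ->
  (u * w)`_n = (v * w)`_n.
  by move=> uv; rewrite !coefM; apply: eq_bigr => i _; rewrite uv // -ltnS.
have trfg u v i : (i <= n)%N ->
  (fps_trunc n (fps_mul u v))`_i = (fps_trunc n u * fps_trunc n v)`_i.
  by move=> le_in; rewrite coef_fps_trunc // (fcoef_mul _ _ le_in).
by rewrite mulrC (trM _ _ _ (trfg g h)) (trM _ _ _ (trfg f g)) mulrC mulrA.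
Qed.

Lemma fps_mulC : commutative fps_mul.
Proof. by move=> f g; apply: fpsP => n; rewrite !(@fcoef_mul n) // mulrC. Qed.

Lemma fps_mul1 : left_id (fpsC 1) fps_mul.
Proof.
move=> f; apply: fpsP => n /=; rewrite big_ord_recl /= subn0 mul1r.
by rewrite big1 ?addr0 // => i _; rewrite mul0r.
Qed.

Lemma fps_mulDl : left_distributive fps_mul +%R.
Proof.
move=> f g h; apply: fpsP => n /=; rewrite -big_split /=.
by apply: eq_bigr => i _; rewrite mulrDl.
Qed.

Lemma fps_one_neq0 : fpsC 1 != 0.
Proof.
by apply/eqP => /(congr1 (fun f => fcoef f 0)) /= /eqP; rewrite oner_eq0.
Qed.

HB.instance Definition _ := GRing.Zmodule_isComNzRing.Build (fps R)
  fps_mulA fps_mulC fps_mul1 fps_mulDl fps_one_neq0.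

Lemma fcoefM f g n :
  fcoef (f * g) n = \sum_(i < n.+1) fcoef f i * fcoef g (n - i)%N.
Proof. by []. Qed.

Lemma fcoef1 n : fcoef (1 : fps R) n = if n == 0%N then 1 else 0.
Proof. by []. Qed.

End Ring.

Arguments fpsX {R}.

Section UnitRing.
Variable R : comUnitRingType.
Implicit Types f g : fps R.

Definition fps_unit : {pred fps R} := fun f => fcoef f 0 \is a GRing.unit.

(* The first n + 1 coefficients of 1/f, by solving f * g = 1 degree by degree. *)
Fixpoint fps_inv_seq f n : seq R :=
  if n is m.+1 then
    let s := fps_inv_seq f m in
    rcons s (- (fcoef f 0)^-1 * \sum_(i < n) fcoef f i.+1 * s`_(m - i))
  else [:: (fcoef f 0)^-1].

Definition fps_inv f : fps R :=
  if f \in fps_unit then Fps (fun n => (fps_inv_seq f n)`_n) else f.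

Lemma size_fps_inv_seq f n : size (fps_inv_seq f n) = n.+1.
Proof. by elim: n => //= n IHn; rewrite size_rcons IHn. Qed.

Lemma nth_fps_inv_seq f n i :
  (i <= n)%N -> (fps_inv_seq f n)`_i = (fps_inv_seq f i)`_i.
Proof.
elim: n => [|n IHn]; first by rewrite leqn0 => /eqP->.
rewrite leq_eqVlt => /predU1P[-> //|lt_in].
by rewrite /= nth_rcons size_fps_inv_seq lt_in IHn.
Qed.

Lemma fps_mulVx : {in fps_unit, left_inverse 1 fps_inv *%R}.
Proof.
move=> f fU; rewrite mulrC /fps_inv fU; apply: fpsP => n.
have f0U : fcoef f 0 \is a GRing.unit := fU.
rewrite fcoefM fcoef1 big_ord_recl /= subn0.
case: n => [|n]; first by rewrite big_ord0 addr0 /= divrr.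
rewrite /= nth_rcons size_fps_inv_seq ltnn eqxx mulrA mulrN divrr // mulN1r.
apply/eqP; rewrite addrC subr_eq0; apply/eqP/eq_bigr => i _.
by rewrite /bump /= add1n subSS (@nth_fps_inv_seq f n) ?leq_subr.
Qed.

Lemma fps_unitPl f g : g * f = 1 -> fps_unit f.
Proof.
move=> /(congr1 (fun h => fcoef h 0)).
rewrite fcoefM fcoef1 big_ord1 /= subn0 => gf1.
have: fcoef g 0 * fcoef f 0 \is a GRing.unit by rewrite gf1 unitr1.
by rewrite unitrM => /andP[].
Qed.

Lemma fps_inv_out : {in [predC fps_unit], fps_inv =1 id}.
Proof. by move=> f; rewrite inE /= /fps_inv => /negbTE->. Qed.

HB.instance Definition _ := GRing.ComNzRing_hasMulInverse.Build (fps R)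
  fps_mulVx fps_unitPl fps_inv_out.

End UnitRing.

Section Core.
Local Open Scope nat_scope.

Definition core_vertices n : {set 'I_n.+1 * 'I_n.+1} :=
  [set p : 'I_n.+1 * 'I_n.+1 | 1 <= p.1 <= p.2].

Definition core_adj n : rel ('I_n.+1 * 'I_n.+1) := fun p q =>
  [&& p.1 < q.1, q.1 <= p.2 & p.2 < q.2]
  || [&& q.1 < p.1, p.1 <= q.2 & q.2 < p.2].

Definition core_independent n (S : {set 'I_n.+1 * 'I_n.+1}) : bool :=
  (S \subset core_vertices n)
  && [forall p in S, forall q in S, (p != q) ==> ~~ core_adj p q].

Definition num_independent n k : nat :=
  #|[set S : {set 'I_n.+1 * 'I_n.+1} | core_independent S & #|S| == k]|.

End Core.

Definition core_gf : fps (fps rat) :=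
  Fps (fun n => Fps (fun k => (num_independent n k)%:R)).

(* The division by 1 - y (F - 1) is a genuine one. *)
Lemma core_gf_den_unit :
  (1 - fpsC fpsX * (core_gf - 1) : fps (fps rat)) \is a GRing.unit.
Proof.
rewrite -[_ \is a _]/(fcoef (fcoef _ 0) 0 \is a GRing.unit).
by rewrite /= !big_ord1 /= !big_ord1 /= mul0r subr0 unitr1.
Qed.

(* Natural subtraction is truncated, so a binomial coefficient whose lower
   index may be negative needs an integer lower index. *)
Definition binz (m : nat) (r : int) : nat :=
  if r is Posz s then 'C(m, s) else 0%N.

(* Main.v *)
(* Independent sets of the core are laminar families of intervals. Deletion-contraction
   at the intervals starting at the left end of a window shows that the independence
   polynomial of a window depends only on its length, and that G = F - 1 satisfies
   G = x (1 + y) (1 + G) + y G^2, which is equivalent to the functional equation.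
   Multiplying by powers of G gives a linear recurrence in n and p for the coefficient of
   x^n in G^p; it has a unique solution because that coefficient vanishes for p > n, and
   the Lagrange inversion formula is checked to solve it. The case p = 1 is the
   closed form. *)
Require Import Defs.
From mathcomp Require Import all_boot all_order all_algebra.
From mathcomp Require Import ring zify.

Set Implicit Arguments.
Unset Strict Implicit.
Unset Printing Implicit Defensive.

Import GRing.Theory Num.Theory.
Local Open Scope ring_scope.

(** * Independence polynomials of finite graphs *)

Section IndependencePolynomial.
Variables (T : finType) (e : rel T) (R : comNzRingType) (t : R).
Hypothesis e_sym : symmetric e.
Implicit Types A B S : {set T}.

Definition independent S : bool :=
  [forall p in S, forall q in S, (p != q) ==> ~~ e p q].

Definition ind_poly A : R :=
  \sum_(S : {set T} | (S \subset A) && independent S) t ^+ #|S|.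

Lemma independentP S :
  reflect {in S &, forall p q, p != q -> ~~ e p q} (independent S).
Proof.
apply: (iffP forall_inP) => [iS p q pS qS pq|iS p pS].
  by have /forall_inP/(_ q qS)/implyP/(_ pq) := iS p pS.
by apply/forall_inP => q qS; apply/implyP; apply: iS.
Qed.

Lemma independentU1 v S : v \notin S ->
  independent (v |: S) = independent S && [forall u in S, ~~ e v u].
Proof.
move=> vS; apply/independentP/andP => [iS|[/independentP iS /forall_inP vN]].
  split; first by apply/independentP => p q pS qS; apply: iS; rewrite inE ?pS ?qS orbT.
  apply/forall_inP => u uS; apply: iS; rewrite ?inE ?eqxx ?uS ?orbT //.
  by apply: contraNneq vS => ->.
move=> p q; rewrite !inE => /predU1P[->|pS] /predU1P[->|qS]; rewrite ?eqxx //.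
- by move=> _; apply: vN.
- by move=> _; rewrite e_sym; apply: vN.
exact: iS.
Qed.

Lemma ind_poly0 : ind_poly set0 = 1.
Proof.
rewrite /ind_poly (big_pred1 set0) ?cards0 // => S.
rewrite subset0 /=; case: eqP => [->|//].
by apply/independentP => p q; rewrite inE.
Qed.

(** Deletion-contraction: an independent set either avoids [v], or is [v] together with an
    independent set of non-neighbours of [v]. *)
Lemma ind_poly_recl A v : v \in A ->
  ind_poly A = ind_poly (A :\ v)
    + t * ind_poly [set u in A :\ v | ~~ e v u].
Proof.
move=> vA; rewrite /ind_poly (bigID (fun S : {set T} => v \in S)) /= addrC.
congr (_ + _).
  by apply: eq_bigl => S; rewrite subsetD1 -andbA andbCA andbC -andbA.
rewrite (reindex_onto (fun S => v |: S) (fun S => S :\ v)) /=; last first.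
  by move=> S /andP[_ vS]; rewrite setD1K.
rewrite big_distrr /=; apply: eq_big => [S|S /andP[_ /eqP Sv]]; last first.
  by rewrite cardsU1 -Sv !inE eqxx exprS.
have [vS|vS] := boolP (v \in S).
  have -> : (v |: S) :\ v == S = false.
    by apply/eqP => /setP/(_ v) /esym; rewrite !inE eqxx vS.
  rewrite andbF; apply/esym/negbTE; rewrite negb_and; apply/orP; left.
  by apply/negP => /subsetP/(_ v vS); rewrite !inE eqxx.
rewrite setU1K // eqxx andbT setU11 andbT independentU1 // subUset sub1set vA /=.
rewrite andbCA andbC; apply: andb_id2r => _.
apply/andP/subsetP => [[/subsetP SA /forall_inP vN] u uS|SA].
  by rewrite !inE SA // vN // andbT andbT; apply: contraNneq vS => <-.
split; first by apply/subsetP => u /SA; rewrite !inE => /andP[/andP[]].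
by apply/forall_inP => u /SA; rewrite !inE => /andP[].
Qed.

(** Induction on the size of [A]: deletion-contraction at a vertex of [A] acts on both sides alike,
    since it has no neighbour in [B]. *)
Lemma ind_polyU A B : [disjoint A & B] ->
  {in A & B, forall u v, ~~ e u v} ->
  ind_poly (A :|: B) = ind_poly A * ind_poly B.
Proof.
have [n] := ubnP #|A|; elim: n A => // n IHn A.
have [->|[v vA]] := set_0Vmem A; first by rewrite set0U ind_poly0 mul1r.
rewrite ltnS => leA dAB AB.
have ltD : (#|A :\ v| < n)%N by move: leA; rewrite (cardsD1 v) vA.
have sD : A :\ v \subset A := subD1set A v.
have vB : v \notin B by move/pred0P/(_ v): dAB; rewrite /= vA /= => ->.
rewrite (@ind_poly_recl (A :|: B) v) ?inE ?vA // (@ind_poly_recl A v) //.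
have -> : (A :|: B) :\ v = (A :\ v) :|: B.
  apply/setP => u; rewrite !inE; case: eqP => //= ->; exact/esym/negbTE.
have -> : [set u in (A :\ v) :|: B | ~~ e v u]
        = [set u in A :\ v | ~~ e v u] :|: B.
  apply/setP => u; rewrite !inE andb_orl; congr (_ || _).
  by case: (boolP (u \in B)) => //= uB; rewrite AB.
have sN : [set u in A :\ v | ~~ e v u] \subset A :\ v.
  by apply/subsetP => u; rewrite inE => /andP[].
rewrite !IHn //.
- by rewrite mulrDl mulrA.
- exact: leq_ltn_trans (subset_leq_card sN) ltD.
- exact: disjointWl (subset_trans sN sD) dAB.
- by move=> u w /(subsetP sN)/(subsetP sD); apply: AB.
- exact: disjointWl sD dAB.
- by move=> u w /(subsetP sD); apply: AB.
Qed.

Lemma ind_poly_isolated A v : v \in A -> {in A, forall u, ~~ e v u} ->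
  ind_poly A = (1 + t) * ind_poly (A :\ v).
Proof.
move=> vA vN; rewrite (ind_poly_recl vA).
have -> : [set u in A :\ v | ~~ e v u] = A :\ v.
  apply/setP => u; rewrite !inE; case: (boolP (u \in A)) => uA; last by rewrite !andbF.
  by rewrite vN // !andbT.
by rewrite mulrDl mul1r.
Qed.

End IndependencePolynomial.

(** * Recurrence for windows of the core *)

Section Window.
Variables (R : comNzRingType) (t : R).

Lemma core_adj_sym n : symmetric (@core_adj n).
Proof. by move=> p q; rewrite /core_adj orbC. Qed.

(** The intervals contained in the half-open range from [a] to [b]; [n] only fixes the ambient
    type. *)
Definition window n (a b : nat) : {set 'I_n.+1 * 'I_n.+1} :=
  [set p : 'I_n.+1 * 'I_n.+1 | (a <= p.1)%N && (p.1 <= p.2 < b)%N].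

Definition window_poly n a b : R := ind_poly (@core_adj n) t (window n a b).

(** The interval from [a] to [b] contains every other interval of the window, hence crosses none. *)
Lemma window_poly_isolated n (a b : nat) (v := (inord a, inord b) : 'I_n.+1 * 'I_n.+1) :
  (a <= b <= n)%N ->
  window_poly n a b.+1
    = (1 + t) * ind_poly (@core_adj n) t (window n a b.+1 :\ v).
Proof.
move=> /andP[ab bn]; apply: ind_poly_isolated; first exact: core_adj_sym.
  by rewrite !inE /= !inordK ?ab ?leqnn //; lia.
move=> [i j]; rewrite !inE /core_adj /= !inordK; lia.
Qed.

(* Deletion-contraction at (a, c), for the part of the window where the
   intervals starting at a end before c. *)
Lemma ind_poly_window_step n (a b c : nat) (v := (inord a, inord c) : 'I_n.+1 * 'I_n.+1)
    (A := fun d => [set p : 'I_n.+1 * 'I_n.+1 in window n a b | (p.1 == a :> nat) ==> (p.2 < d)%N]) :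
  (a <= c < b)%N -> (b <= n.+1)%N ->
  ind_poly (@core_adj n) t (A c.+1)
    = ind_poly (@core_adj n) t (A c)
      + t * (ind_poly (@core_adj n) t (window n a c.+1 :\ v)
             * window_poly n c.+1 b).
Proof.
move=> /andP[ac cb] bn.
have v1 : v.1 = a :> nat by rewrite /= inordK //; lia.
have v2 : v.2 = c :> nat by rewrite /= inordK //; lia.
have vE (i j : 'I_n.+1) : ((i, j) == v) = (i == a :> nat) && (j == c :> nat).
  by rewrite /v xpair_eqE -!val_eqE /= !inordK //; lia.
rewrite (@ind_poly_recl _ _ _ _ (@core_adj_sym n) _ v); last first.
  by rewrite !inE v1 v2; lia.
congr (ind_poly _ _ _ + t * _).
  apply/setP => -[i j]; rewrite !inE vE /=; lia.
(* An interval that does not cross (a, c) lies inside it or starts after [c], and intervals of these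
   two kinds never cross. *)
rewrite -ind_polyU; first last.
- move=> [i j] [i' j']; rewrite !inE vE /core_adj /=; lia.
- rewrite disjoint_subset; apply/subsetP => -[i j]; rewrite !inE vE /=; lia.
- exact: core_adj_sym.
congr ind_poly; apply/setP => -[i j].
rewrite !inE vE /core_adj v1 v2 /=; lia.
Qed.

Lemma window_poly_rec n a b : (a <= b <= n)%N ->
  window_poly n a b.+1 = (1 + t) * window_poly n a.+1 b.+1
    + t * \sum_(a <= c < b) window_poly n a c.+1 * window_poly n c.+1 b.+1.
Proof.
move=> /andP[ab bn]; rewrite window_poly_isolated ?ab //.
pose A d := [set p : 'I_n.+1 * 'I_n.+1 in window n a b.+1 | (p.1 == a :> nat) ==> (p.2 < d)%N].
have -> : window n a b.+1 :\ (inord a, inord b) = A b.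
  apply/setP => -[i j]; rewrite !inE -pair_eqE /= -!val_eqE /= !inordK; lia.
(* The factor 1 + t contributed by (a, b) is kept, because at each step it restores the interval (a,
   d) missing from the left factor and so completes that window. *)
have AE d : (a <= d <= b)%N -> (1 + t) * ind_poly (@core_adj n) t (A d) =
   (1 + t) * window_poly n a.+1 b.+1
    + t * \sum_(a <= c < d) window_poly n a c.+1 * window_poly n c.+1 b.+1.
  elim: d => [|d IHd] /andP[ad db].
    rewrite big_geq // mulr0 addr0; congr (_ * ind_poly _ _ _).
    by apply/setP => -[i j]; rewrite !inE /=; lia.
  move: ad; rewrite leq_eqVlt => /predU1P[<-|]; last rewrite ltnS => ad.
    rewrite big_geq // mulr0 addr0; congr (_ * ind_poly _ _ _).
    by apply/setP => -[i j]; rewrite !inE /=; lia.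
  rewrite ind_poly_window_step; [|lia|lia].
  rewrite mulrDr IHd; last lia.
  rewrite big_nat_recr //= (@window_poly_isolated n a d); last lia.
  by ring.
by apply: AE; rewrite ab leqnn.
Qed.

Lemma window_poly_nil n a : window_poly n a a = 1.
Proof.
rewrite /window_poly; have -> : window n a a = set0; last exact: ind_poly0.
by apply/setP => -[i j]; rewrite !inE /=; lia.
Qed.

(** Strong induction on the length [d]: the recurrence involves shorter windows only, with lengths
    independent of the position. *)
Lemma window_poly_shift m n a b d :
  (a + d <= n.+1)%N -> (b + d <= m.+1)%N ->
  window_poly n a (a + d) = window_poly m b (b + d).
Proof.
have [k] := ubnP d; elim: k a b d => // k IHk a b [|d] ltd an bm.
  by rewrite !addn0 !window_poly_nil.
rewrite !addnS (@window_poly_rec n a) ?(@window_poly_rec m b); [|lia|lia].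
rewrite -!addSn (IHk a.+1 b.+1); [|lia|lia|lia].
congr (_ + t * _); rewrite -{1}[a]add0n -{1}[b]add0n ![(_ + d)%N]addnC.
rewrite !big_addn !addnK; apply: eq_big_nat => c /andP[_ cd]; congr (_ * _).
  rewrite ![(c + _)%N]addnC -!addnS; apply: IHk; lia.
have E x : (d + x).+1 = ((c + x).+1 + (d - c))%N by lia.
by rewrite !addnS !E; apply: IHk; lia.
Qed.

End Window.

(** * Coefficients of formal power series *)

Section FormalSeries.
Variable R : comNzRingType.
Implicit Types (f g : fps R) (c : R).

Lemma fcoefD f g n : fcoef (f + g) n = fcoef f n + fcoef g n.
Proof. by []. Qed.

Lemma fcoefB f g n : fcoef (f - g) n = fcoef f n - fcoef g n.
Proof. by []. Qed.

Lemma fcoef_sum (I : Type) (r : seq I) (P : pred I) (F : I -> fps R) n :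
  fcoef (\sum_(i <- r | P i) F i) n = \sum_(i <- r | P i) fcoef (F i) n.
Proof. exact: (big_morph (fun f => fcoef f n)). Qed.

Lemma fcoefCM c f n : fcoef (fpsC c * f) n = c * fcoef f n.
Proof.
by rewrite fcoefM big_ord_recl /= subn0 big1 ?addr0 // => i _; rewrite mul0r.
Qed.

Lemma fcoefXM0 f : fcoef (fpsX * f) 0 = 0.
Proof. by rewrite fcoefM big_ord1 /= mul0r. Qed.

Lemma fcoefXMS f n : fcoef (fpsX * f) n.+1 = fcoef f n.
Proof.
rewrite fcoefM !big_ord_recl /= mul0r add0r mul1r subSS subn0.
by rewrite big1 ?addr0 // => i _; rewrite mul0r.
Qed.

Lemma fcoefXn m n : fcoef (fpsX ^+ m : fps R) n = (n == m)%:R.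
Proof.
elim: m n => [|m IHm] [|n] //; first by rewrite exprS fcoefXM0.
by rewrite exprS fcoefXMS IHm.
Qed.

Lemma fcoef_1X_exp m n : fcoef ((1 + fpsX) ^+ m : fps R) n = 'C(m, n)%:R.
Proof.
elim: m n => [|m IHm] [|n] //; rewrite exprS mulrDl mul1r fcoefD.
  by rewrite IHm fcoefXM0 addr0 !bin0.
by rewrite !IHm fcoefXMS IHm binS natrD.
Qed.

Lemma fcoef_exp_small f n p : fcoef f 0 = 0 -> (n < p)%N -> fcoef (f ^+ p) n = 0.
Proof.
move=> f0; elim: p n => // p IHp n lenp; rewrite exprS fcoefM big1 // => -[i /= lei] _.
case: i lei => [|i] lei; first by rewrite f0 mul0r.
by rewrite IHp ?mulr0 //; lia.
Qed.

End FormalSeries.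

(** * The generating function and its quadratic equation *)

Lemma fcoef_core_gf n : fcoef core_gf n = window_poly (fpsX : fps rat) n 1 n.+1.
Proof.
apply: fpsP => k; rewrite /window_poly /ind_poly fcoef_sum /= /num_independent.
rewrite -sum1_card natr_sum big_mkcond [RHS]big_mkcond /=.
apply: eq_bigr => S _; rewrite fcoefXn inE /core_independent /independent.
have -> : window n 1 n.+1 = core_vertices n.
  by apply/setP => -[i j]; rewrite !inE /= (ltn_ord j) andbT.
by rewrite [k == _]eq_sym mulrb !if_and.
Qed.

Lemma fcoef_core_gf0 : fcoef core_gf 0 = 1.
Proof. by rewrite fcoef_core_gf window_poly_nil. Qed.

Lemma fcoef_core_gfS n :
  fcoef core_gf n.+1 = (1 + fpsX) * fcoef core_gf n
    + fpsX * \sum_(i < n) fcoef core_gf i.+1 * fcoef core_gf (n - i).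
Proof.
rewrite !fcoef_core_gf window_poly_rec ?leqnn //; congr (_ * _ + _ * _).
  by apply: (@window_poly_shift _ _ n n.+1 2 1 n); lia.
(* With c = i + 1, the two windows have lengths i + 1 and n - i. *)
rewrite -(addn1 n) -{1}[1%N]add0n big_addn addnK big_mkord.
apply: eq_bigr => -[i lin] _; rewrite !fcoef_core_gf /= !addn1; congr (_ * _).
  by apply: (@window_poly_shift _ _ i.+1 n.+1 1 1 i.+1); lia.
have -> : n.+2 = (i.+2 + (n - i))%N by lia.
by apply: (@window_poly_shift _ _ (n - i) n.+1 i.+2 1 (n - i)); lia.
Qed.

Lemma core_gf_quadratic (G := core_gf - 1) :
  G - fpsC fpsX * G ^+ 2 = fpsX * (fpsC (1 + fpsX) * (1 + G)).
Proof.
have G0 : fcoef G 0 = 0 by rewrite fcoefB fcoef_core_gf0 subrr.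
have GS n : fcoef G n.+1 = fcoef core_gf n.+1 by rewrite fcoefB fcoef1 subr0.
have -> : 1 + G = core_gf by rewrite addrC subrK.
apply: fpsP => -[|n]; rewrite fcoefB fcoefCM.
  by rewrite fcoefXM0 fcoef_exp_small // G0 mulr0 subrr.
rewrite fcoefXMS fcoefCM GS fcoef_core_gfS; apply/eqP; rewrite subr_eq; apply/eqP.
congr (_ + _ * _); move: core_gf G G0 GS => F G G0 GS.
(* Both end terms of the convolution vanish because G has no constant term; in the others [G] and
   [F] have the same coefficients. *)
rewrite expr2 fcoefM big_ord_recl G0 mul0r add0r.
rewrite big_ord_recr /= /bump /= add1n subnn G0 mulr0 addr0.
apply: eq_bigr => -[i lin] _ /=; rewrite add1n GS subSS.
have -> : (n - i = (n - i).-1.+1)%N by lia.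
congr (_ * _); exact/esym/GS.
Qed.

(** * Powers of G and the Lagrange coefficients *)

Lemma natr_bin_left (R : comNzRingType) n m :
  m.+1%:R * 'C(n, m.+1)%:R = (n%:R - m%:R) * 'C(n, m)%:R :> R.
Proof.
have [le_mn|lt_nm] := leqP m n.
  by rewrite -natrM mul_bin_left natrM natrB.
by rewrite !bin_small ?mulr0 // ltnW.
Qed.

Lemma natr_bin_diag (R : comNzRingType) n m :
  m.+1%:R * 'C(n.+1, m.+1)%:R = n.+1%:R * 'C(n, m)%:R :> R.
Proof. by rewrite -!natrM -mul_bin_diag. Qed.

(* The coefficient of x^(n+1) in G^p, up to the factor (1 + y)^(n+1), as given
   by Lagrange inversion for G = x (1 + y) (1 + G) / (1 - y G). *)
Definition lagrange_coef n p : fps rat :=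
  Fps (fun j => p%:R / n.+1%:R * 'C(n.+1, p + j)%:R * 'C(n + j, j)%:R).

Lemma lagrange_coef_small n p : (n.+1 < p)%N -> lagrange_coef n p = 0.
Proof.
move=> ltnp; apply: fpsP => j /=; rewrite (@bin_small n.+1) ?mulr0 ?mul0r //.
exact: leq_trans (leq_addr _ _).
Qed.

(** This is the recurrence for the coefficients of the powers of G, divided by (1 + y)^(n+2). *)
Lemma lagrange_coef_rec n p :
  lagrange_coef n.+1 p.+1 - fpsX * lagrange_coef n.+1 p.+2
    = lagrange_coef n p + lagrange_coef n p.+1.
Proof.
have nz k : (k.+1%:R : rat) != 0 by rewrite pnatr_eq0.
(* Solved for the binomial with lower index m + 1, these identities reduce all terms to common
   binomials with rational factors, which [field] can compare. *)
have binl k m := canRL (mulKf (nz m)) (natr_bin_left rat k m).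
have bind k m := canRL (mulKf (nz m)) (natr_bin_diag rat k m).
apply: fpsP => -[|i]; rewrite fcoefB fcoefD.
  rewrite fcoefXM0 subr0 /lagrange_coef /fcoef !addn0 !bin0 !mulr1.
  rewrite bind binl !mulrS; field.
  by rewrite -!mulrS !pnatr_eq0.
rewrite fcoefXMS /lagrange_coef /fcoef !(addSn, addnS).
rewrite (bind n.+1) (bind (n + i).+1) !binl !mulrS !natrD; field.
by rewrite -natrD -!mulrS !pnatr_eq0.
Qed.

Lemma fcoef_core_gf_exp n p :
  fcoef ((core_gf - 1) ^+ p) n.+1 = (1 + fpsX) ^+ n.+1 * lagrange_coef n p.
Proof.
set G := core_gf - 1.
have G0 : fcoef G 0 = 0 by rewrite fcoefB fcoef_core_gf0 subrr.
(* The quadratic equation times G^q, read off in degree m + 1. *)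
have GE m q : fcoef (G ^+ q.+1) m.+1 = fpsX * fcoef (G ^+ q.+2) m.+1
    + (1 + fpsX) * (fcoef (G ^+ q) m + fcoef (G ^+ q.+1) m).
  have /(congr1 (fun f => fcoef f m.+1)) : G ^+ q.+1 - fpsC fpsX * G ^+ q.+2
      = fpsX * (fpsC (1 + fpsX) * (G ^+ q + G ^+ q.+1)).
    transitivity ((G - fpsC fpsX * G ^+ 2) * G ^+ q); first by rewrite !exprS; ring.
    by rewrite core_gf_quadratic -/G !exprS; ring.
  rewrite fcoefB fcoefCM fcoefXMS fcoefCM fcoefD => /eqP.
  by rewrite subr_eq addrC => /eqP.
have exp0 m : fcoef (G ^+ 0) m.+1 = (1 + fpsX) ^+ m.+1 * lagrange_coef m 0.
  rewrite expr0 fcoef1; have -> : lagrange_coef m 0 = 0; last by rewrite mulr0.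
  by apply: fpsP => j; rewrite /= !mul0r.
elim: n p => [|n IHn] p.
  case: p => [|[|p]]; first exact: exp0.
    rewrite GE (@fcoef_exp_small _ G 1 2) // (@fcoef_exp_small _ G 0 1) //.
    rewrite expr0 fcoef1 mulr0 add0r addr0 expr1; congr (_ * _).
    apply: fpsP => -[|j]; rewrite /lagrange_coef /fcoef ?divr1.
      by [].
    by rewrite mulr0 mul0r.
  by rewrite lagrange_coef_small // mulr0 fcoef_exp_small.
(* Since [GE] calls on a higher power in the same degree, the induction on [p] descends, starting
   from p > n + 2 where both sides vanish. *)
have [d] := ubnP (n.+3 - p); elim: d p => // d IHd p ltd.
have [lt|ge] := ltnP n.+2 p.
  by rewrite lagrange_coef_small // mulr0 fcoef_exp_small.
case: p => [|p] in ltd ge *; first exact: exp0.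
rewrite GE IHd; last lia.
rewrite !IHn -!mulrDr -lagrange_coef_rec exprS; ring.
Qed.

(** * The functional equation and the closed form *)

Theorem mainTheorem2 :
  (let x : fps (fps rat) := fpsX in
   let y : fps (fps rat) := fpsC fpsX in
   let F := core_gf in
   F = 1 + x * F + (x * y * F ^+ 2) / (1 - y * (F - 1)))
  /\
  (forall n k : nat, (1 <= n)%N ->
     (num_independent n k)%:R =
       n%:R^-1 * \sum_(0 <= j < n)
         ((binz n (k%:Z - j%:Z))%:R * ('C(n, j.+1))%:R
            * ('C(n - 1 + j, n - 1))%:R) :> rat).
Proof.
split=> [x y F|[//|n] k _].
  apply: (mulIr core_gf_den_unit); rewrite mulrDl divrK ?core_gf_den_unit //.
  have fpsC1X : fpsC (1 + fpsX) = 1 + y by apply: fpsP => -[|i] //=; rewrite addr0.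
  have := core_gf_quadratic; rewrite fpsC1X -/F -/x -/y => quad.
  (* The left side F (1 - y (F - 1)) is rearranged to exhibit the left side of [quad]. *)
  transitivity ((F - 1 - y * (F - 1) ^+ 2) + 1 - y * (F - 1)); first by ring.
  by rewrite quad; ring.
pose h j : rat := (binz n.+1 (k%:Z - j%:Z))%:R * 'C(n.+1, j.+1)%:R * 'C(n + j, n)%:R.
(* The case p = 1: the convolution with (1 + y)^(n+1) gives a sum over j <= k. *)
have -> : (num_independent n.+1 k)%:R = n.+1%:R^-1 * \sum_(j < k.+1) h j.
  transitivity (fcoef (fcoef ((core_gf - 1) ^+ 1) n.+1) k).
    by rewrite expr1 !fcoefB fcoef1 subr0.
  rewrite fcoef_core_gf_exp mulrC fcoefM big_distrr; apply: eq_bigr => -[j lej] _.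
  rewrite fcoef_1X_exp /h /= add1n subzn; last by rewrite -ltnS.
  by rewrite -(bin_sub (leq_addr j n)) addKn mul1r /=; ring.
rewrite subn1 -pred_Sn; congr (_ * _); rewrite -(big_mkord xpredT h).
(* The ranges j <= k and j <= n may differ, but [h] vanishes beyond either bound, so both sums
   extend to a common range. *)
have hk j : (k < j)%N -> h j = 0.
  move=> ltkj; rewrite /h -opprB subzn ?(ltnW ltkj) //.
  by rewrite -[(j - k)%N]prednK ?subn_gt0 // -NegzE !mul0r.
have hn j : (n < j)%N -> h j = 0.
  by move=> ltnj; rewrite /h bin_small ?mulr0 ?mul0r.
transitivity (\sum_(0 <= j < k.+1 + n.+1) h j).
  rewrite (@big_cat_nat _ _ _ k.+1 0 (k.+1 + n.+1)) ?leq_addr //= [X in _ + X]big_nat_cond.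
  by rewrite [X in _ + X]big1 ?addr0 // => j /andP[/andP[/hk]].
rewrite (@big_cat_nat _ _ _ n.+1 0 (k.+1 + n.+1)) ?leq_addl //= [X in _ + X]big_nat_cond.
by rewrite [X in _ + X]big1 ?addr0 // => j /andP[/andP[/hn]].
Qed.
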